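(* Let $r\ge 3$ and $H:=K_{t_1,\dots,t_r}$ with $t_i\ge 2$ for all $1\le i\le r$. Let $n\in\mathbb N$ be sufficiently large and such that $\sqrt n$ is an integer that is divisible by $6r^2|H|$. Set $C:=\sqrt n/(3r^2)$. Then there exists a graph $G$ on $n$ vertices whose degree sequence $d_1\le\dots\le d_n$ satisfies $$d_i\ge \frac{(r-2)n}{r}+i+C\quad\text{for all } 1\le i\le \frac nr,$$ but such that $G$ does not contain a perfect $H$-packing.
   Context: Graphs are finite and simple; $|H|$ is the number of vertices of $H$. $K_{t_1,\dots,t_r}$ denotes the complete $r$-partite graph with vertex classes of sizes $t_1,\dots,t_r$. The degree sequence lists the vertex degrees of $G$ in non-decreasing order. An $H$-packing in $G$ is a collection of vertex-disjoint copies of $H$ in $G$ (as not necessarily induced subgraphs); it is perfect if it covers all vertices of $G$. *)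

(* Defs.v *)
From mathcomp Require Import all_boot all_order all_algebra.

Set Implicit Arguments.
Unset Strict Implicit.
Unset Printing Implicit Defensive.

Record sgraph := SGraph {
  vertex :> finType;
  adj : rel vertex;
  adj_sym : symmetric adj;
  adj_irrefl : irreflexive adj }.

Definition degree (G : sgraph) (x : G) : nat := #|[set y | adj x y]|.

(* Listed from index 0: the i-th smallest degree d_i is the entry of index i - 1. *)
Definition degree_sequence (G : sgraph) : seq nat :=
  sort leq [seq degree x | x <- enum G].

Section CompleteMultipartite.
Variables (r : nat) (t : 'I_r -> nat).

(* A vertex is a pair (class i, index in 'I_(t i)). *)
Definition multipartite_vertex : finType := {i : 'I_r & 'I_(t i)}.

Definition multipartite_adj : rel multipartite_vertex :=
  fun x y => tag x != tag y.

Fact multipartite_sym : symmetric multipartite_adj.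
Proof. by move=> x y; rewrite /multipartite_adj eq_sym. Qed.

Fact multipartite_irrefl : irreflexive multipartite_adj.
Proof. by move=> x; rewrite /multipartite_adj eqxx. Qed.

Definition complete_multipartite : sgraph :=
  SGraph multipartite_sym multipartite_irrefl.

End CompleteMultipartite.

Section Packing.
Variables (H G : sgraph).

(* A copy of H in G, not necessarily induced, is given by an embedding: an
   injective map sending edges to edges, the copy being its image. *)
Definition is_copy (f : {ffun H -> G}) : Prop :=
  injective f /\ (forall x y : H, adj x y -> adj (f x) (f y)).

Definition copy_vertices (f : {ffun H -> G}) : {set G} := [set f x | x : H].

Definition packing (P : {set {ffun H -> G}}) : Prop :=
  (forall f, f \in P -> is_copy f) /\
  (forall f g, f \in P -> g \in P -> f != g ->
     [disjoint copy_vertices f & copy_vertices g]).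

Definition perfect_packing (P : {set {ffun H -> G}}) : Prop :=
  packing P /\ \bigcup_(f in P) copy_vertices f = [set: G].

End Packing.

(* Main.v *)
Require Import Defs.
From mathcomp Require Import all_boot all_order all_algebra.
From mathcomp Require Import zify ring.

(** Write q = n / r. The graph contains one vertex v, of smallest degree
    (r-2)q + C + 1, that lies in no copy of H at all; this already rules out a
    perfect packing.

    Outside v the graph consists of a neighbourhood N(v) and a clique W of
    2q - C - 2 further vertices, every vertex of W being joined to all of N(v).
    The neighbourhood is the join of r-3 independent sets of size q - C and of
    one graph F on q + (r-2)C + 1 vertices without a 4-cycle. If v played the
    role of a vertex of H, the other r-1 parts of H, each with two vertices at
    least, would lie in N(v). An independent set meets at most one part, so at
    least two parts would lie entirely in F and span a 4-cycle there
    (apex_not_covered).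

    It remains to choose F so that the degree condition holds. The vertices of
    W and of the independent sets have degree at least (r-1)q + C, which is
    the largest bound required. A vertex isolated in F has degree
    (r-1)q - (r-2)C - 1, which is enough for the indices i < q - (r-1)C. Hence
    it suffices that (2r-3)C + 3 vertices of F have degree (r-1)C + 1 inside F:
    then v and the remaining vertices of F occupy only those small indices.
    Disjoint stars do this without creating a 4-cycle, and they need about
    2 r^2 C^2 vertices altogether. This fits into F because q = 9 r^3 C^2
    when C = sqrt n / (3 r^2); it is the reason why C has order sqrt n. The
    construction works as soon as C is positive, hence for all n >= 1. *)

Set Implicit Arguments.
Unset Strict Implicit.
Unset Printing Implicit Defensive.

Import GRing.Theory Num.Theory.

(** * Counting and degree sequences *)

Lemma card_sum_pred (A B : finType) (P : pred (A + B)) :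
  #|P| = #|[pred x | P (inl x)]| + #|[pred y | P (inr y)]|.
Proof. by rewrite -!sum1_card big_sumType. Qed.

(** A list with at most j entries below b has its entry of index j, in sorted
    order, at least b: otherwise the j + 1 entries up to that index would all
    be below b. *)
Lemma leq_nth_sort (l : seq nat) (b j : nat) :
  j < size l -> count (fun d => d < b) l <= j -> b <= nth 0 (sort leq l) j.
Proof.
move=> ltj; apply: contraTT; rewrite -!ltnNge => lt_b.
have -> : count (fun d => d < b) l = count (fun d => d < b) (sort leq l).
  by apply/esym/permP; rewrite perm_sort.
rewrite -(cat_take_drop j.+1 (sort leq l)) count_cat.
have sz : size (take j.+1 (sort leq l)) = j.+1.
  by rewrite size_takel // size_sort.
suff : all (fun d => d < b) (take j.+1 (sort leq l)).
  by rewrite all_count => /eqP ->; rewrite sz leq_addr.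
apply/(all_nthP 0) => i; rewrite sz => lti; rewrite nth_take //.
apply: leq_ltn_trans lt_b.
have srt : sorted leq (sort leq l) by apply: sort_sorted; exact: leq_total.
apply: (sorted_leq_nth leq_trans leqnn 0 srt) => //; rewrite inE size_sort //.
by apply: leq_ltn_trans ltj.
Qed.

(** Reduces a lower bound on the degree sequence to counting vertices of low
    degree, which splits along the pieces of a join. *)
Lemma degree_sequence_geq (G : sgraph) (b j : nat) :
  j < #|G| -> #|[pred x : G | degree x < b]| <= j ->
  b <= nth 0 (degree_sequence G) j.
Proof.
move=> ltj le_j; apply: leq_nth_sort; first by rewrite size_map -cardE.
rewrite count_map; apply: leq_trans le_j.
by rewrite enumT cardE /enum_mem size_filter.
Qed.

Lemma card_complete_multipartite (r : nat) (t : 'I_r -> nat) :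
  #|complete_multipartite t| = \sum_i t i.
Proof.
rewrite [LHS]card_tagged sumnE big_map big_enum.
by apply: eq_bigr => i _; rewrite card_ord.
Qed.

Lemma degree_complete_multipartite (r : nat) (t : 'I_r -> nat)
    (x : complete_multipartite t) :
  degree x = #|complete_multipartite t| - t (tag x).
Proof.
rewrite /degree cardsE.
have /= <- := cardC [pred y : complete_multipartite t | adj x y].
have -> : #|[predC [pred y : complete_multipartite t | adj x y]]| = t (tag x).
  have inj_cell : injective (fun a : 'I_(t (tag x)) =>
      Tagged (fun i => 'I_(t i)) a : complete_multipartite t).
    by move=> a b /eqP; rewrite eq_Tagged => /eqP.
  rewrite -[t (tag x) in RHS]card_ord -(card_imset _ inj_cell).
  apply: eq_card => -[i a]; rewrite !inE /= /multipartite_adj /= negbK.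
  apply/eqP/imsetP => [E | [b _ /(congr1 tag) /= ->] //].
  by case: _ / E a => a; exists a.
by rewrite addnK.
Qed.

(** * Joins *)

Section Join.
Variables G1 G2 : sgraph.

Definition join_adj : rel (G1 + G2) := fun x y =>
  match x, y with
  | inl a, inl b => adj a b
  | inr a, inr b => adj a b
  | _, _ => true
  end.

Fact join_sym : symmetric join_adj.
Proof. by move=> [a|a] [b|b] //=; exact: adj_sym. Qed.

Fact join_irrefl : irreflexive join_adj.
Proof. by move=> [a|a] //=; exact: adj_irrefl. Qed.

Definition join : sgraph := SGraph join_sym join_irrefl.

Lemma degree_joinl (x : G1) : degree (inl x : join) = degree x + #|G2|.
Proof. by rewrite /degree !cardsE card_sum_pred. Qed.

Lemma degree_joinr (x : G2) : degree (inr x : join) = degree x + #|G1|.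
Proof. by rewrite /degree !cardsE card_sum_pred addnC. Qed.

Lemma card_low_join (b : nat) :
  #|[pred x : join | degree x < b]| =
  #|[pred x : G1 | degree x + #|G2| < b]| +
  #|[pred x : G2 | degree x + #|G1| < b]|.
Proof.
rewrite card_sum_pred; congr (_ + _); apply: eq_card => x; rewrite !inE.
  by rewrite degree_joinl.
by rewrite degree_joinr.
Qed.

End Join.

(** * Star forests *)

Section StarForest.
Variables k L e : nat.

(** There are k stars with L leaves each and e isolated vertices; in the star
    of index i the centre is (i, None) and the leaves are (i, Some l). *)
Definition star_forest_adj : rel ('I_k * option 'I_L + 'I_e) := fun x y =>
  match x, y with
  | inl (i, a), inl (j, b) => (i == j) && (isSome a (+) isSome b)
  | _, _ => false
  end.

Fact star_forest_sym : symmetric star_forest_adj.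
Proof. by move=> [[i a]|a] [[j b]|b] //=; rewrite eq_sym addbC. Qed.

Fact star_forest_irrefl : irreflexive star_forest_adj.
Proof. by move=> [[i a]|a] //=; rewrite addbb andbF. Qed.

Definition star_forest : sgraph := SGraph star_forest_sym star_forest_irrefl.

Lemma card_star_forest : #|star_forest| = k * L.+1 + e.
Proof. by rewrite card_sum card_prod card_option !card_ord. Qed.

Lemma degree_star_center (i : 'I_k) : L <= degree (inl (i, None) : star_forest).
Proof.
rewrite -[L in L <= _]card_ord.
have inj_leaf : injective (fun l : 'I_L => inl (i, Some l) : star_forest).
  by move=> l l' [].
rewrite -(card_imset _ inj_leaf); apply: subset_leq_card.
by apply/subsetP => _ /imsetP [l _ ->]; rewrite inE /= eqxx.
Qed.

(** Centres are not low, so only the k * L leaves and the e isolated vertices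
    can be. *)
Lemma card_low_star_forest (d : nat) :
  d <= L -> #|[pred x : star_forest | degree x < d]| <= k * L + e.
Proof.
move=> led; rewrite card_sum_pred leq_add //.
  pose leaf (p : 'I_k * 'I_L) := (p.1, Some p.2).
  rewrite -[in X in _ <= X](card_ord k) -[in X in _ <= X](card_ord L) -card_prod.
  apply: leq_trans (leq_imset_card leaf predT).
  apply: subset_leq_card; apply/subsetP => -[i [l|]]; rewrite !inE => low.
    by apply/imsetP; exists (i, l).
  by have := leq_trans led (degree_star_center i); rewrite leqNgt low.
by rewrite -[in X in _ <= X](card_ord e) max_card.
Qed.

(** Two vertices with a common neighbour in a star forest lie in one star; if
    they are distinct they are leaves, and the centre is their only common
    neighbour. *)
Lemma star_forest_C4_free (p0 p1 q0 q1 : star_forest) :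
  p0 != p1 -> q0 != q1 ->
  adj p0 q0 -> adj p0 q1 -> adj p1 q0 -> adj p1 q1 -> False.
Proof.
case: p0 => [[i0 a0]|//]; case: p1 => [[i1 a1]|//=].
  case: q0 => [[j0 b0]|//]; case: q1 => [[j1 b1]|//] /=.
  move=> np nq /andP [/eqP ? A] /andP [/eqP ? B] /andP [/eqP ? D] _; subst.
  by case: a0 a1 b0 b1 np nq A B D => [?|] [?|] [?|] [?|] //=; rewrite ?eqxx.
Qed.

End StarForest.

(** * A clique and an isolated vertex *)

Section PointedClique.
Variable w : nat.

(** The isolated vertex None becomes the vertex v that no copy covers, and the
    clique becomes W. Keeping both in one graph makes the whole construction a
    join, since v and W have the same neighbours outside. *)
Definition pointed_clique_adj : rel (option 'I_w) := fun x y =>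
  [&& x != y, isSome x & isSome y].

Fact pointed_clique_sym : symmetric pointed_clique_adj.
Proof. by move=> x y; rewrite /pointed_clique_adj eq_sym [isSome x && _]andbC. Qed.

Fact pointed_clique_irrefl : irreflexive pointed_clique_adj.
Proof. by move=> x; rewrite /pointed_clique_adj eqxx. Qed.

Definition pointed_clique : sgraph :=
  SGraph pointed_clique_sym pointed_clique_irrefl.

Lemma card_pointed_clique : #|pointed_clique| = w.+1.
Proof. by rewrite card_option card_ord. Qed.

Lemma degree_clique_vertex (a : 'I_w) :
  w.-1 <= degree (Some a : pointed_clique).
Proof.
have cardw : #|[set~ a]| = w.-1 by rewrite cardsC1 card_ord.
rewrite -cardw -(card_imset _ Some_inj); apply: subset_leq_card.
apply/subsetP => _ /imsetP [b nba ->]; move: nba.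
by rewrite !inE /= /pointed_clique_adj /= andbT eq_sym.
Qed.

Lemma card_low_pointed_clique (d : nat) :
  d <= w.-1 -> #|[pred x : pointed_clique | degree x < d]| <= (0 < d).
Proof.
move=> led; case: (posnP d) => [->|_].
  by rewrite eq_card0.
rewrite /= -(card1 (None : pointed_clique)); apply: subset_leq_card.
apply/subsetP => -[a|]; rewrite !inE // => low.
by have := leq_trans led (degree_clique_vertex a); rewrite leqNgt low.
Qed.

End PointedClique.

(** * A vertex that lies in no copy *)

(** If the isolated vertex of the pointed clique were the image of a vertex of
    part i, all other parts would be mapped into the join of F and T. Each of
    the m classes of T receives vertices of at most one part, so two of the
    m + 2 parts other than i are mapped entirely into F. Two vertices of one of
    them and two of the other form a 4-cycle in F. *)
Lemma apex_not_covered (m w a : nat) (F : sgraph) (t : 'I_m.+3 -> nat) :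
  (forall i, 2 <= t i) ->
  (forall p0 p1 q0 q1 : F, p0 != p1 -> q0 != q1 ->
     adj p0 q0 -> adj p0 q1 -> adj p1 q0 -> adj p1 q1 -> False) ->
  let T := complete_multipartite (fun _ : 'I_m => a) in
  let G := join (join F T) (pointed_clique w) in
  forall f : {ffun complete_multipartite t -> G},
    is_copy f -> (inr None : G) \notin copy_vertices f.
Proof.
move=> t2 C4free T G f [f_inj f_adj]; apply/negP => /imsetP [x _ fx].
pose i := tag x.
have fN y : tag y != i -> exists u : join F T, f y = inl u.
  move=> ny; have := f_adj x y; rewrite -fx /= /multipartite_adj eq_sym ny.
  case: (f y) => [u _|[b|]]; first by exists u.
    by move=> /(_ isT).
  by move=> /(_ isT).
(* part c is the only part with a vertex mapped into class c of T; when no part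
   has one, the value i is harmless because i is excluded anyway. *)
pose inT (c : 'I_m) (z : G) :=
  if z is inl (inr u) then tag u == c else false.
pose part c := if [pick y | inT c (f y)] is Some y then tag y else i.
have partP y c : inT c (f y) -> tag y = part c.
  rewrite /part => yc; case: pickP => [y' yc'|/(_ y)]; last by rewrite yc.
  apply/eqP/negPn/negP => ne; have := f_adj y y' ne.
  move: yc yc'; rewrite /inT.
  case: (f y) => [[//|u]|//] /eqP <-; case: (f y') => [[//|u']|//] /eqP eu.
  by rewrite /= /multipartite_adj eu eqxx.
pose B := [set part c | c : 'I_m].
have card_free : 1 < #|~: (i |: B)|.
  have := cardsC (i |: B); rewrite card_ord.
  have : #|i |: B| <= m.+1.
    rewrite cardsU1; have : #|B| <= m.
      by rewrite -[m in _ <= m]card_ord; exact: leq_imset_card.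
    by case: (_ \notin _) => ?; lia.
  lia.
have [p [q [pfree qfree npq]]] := card_gt1P card_free.
have inF j y : j \in ~: (i |: B) -> tag y = j -> exists u : F, f y = inl (inl u).
  rewrite !inE negb_or => /andP [nji /negP njB] yj.
  have [|[u|u] fyu] := fN y; [by rewrite yj | by exists u |].
  case: njB; apply/imsetP; exists (tag u) => //.
  by rewrite -yj; apply: partP; rewrite fyu /inT eqxx.
pose v j b (ltb : b < t j) : complete_multipartite t :=
  Tagged (fun j => 'I_(t j)) (Ordinal ltb).
have t1 j : 0 < t j by apply: ltnW.
have [p0 e_p0] := inF p (v p 0 (t1 p)) pfree erefl.
have [p1 e_p1] := inF p (v p 1 (t2 p)) pfree erefl.
have [q0 e_q0] := inF q (v q 0 (t1 q)) qfree erefl.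
have [q1 e_q1] := inF q (v q 1 (t2 q)) qfree erefl.
have neq j (u0 u1 : F) : f (v j 0 (t1 j)) = inl (inl u0) ->
    f (v j 1 (t2 j)) = inl (inl u1) -> u0 != u1.
  move=> e0 e1; apply/eqP => e01.
  have : f (v j 0 (t1 j)) = f (v j 1 (t2 j)) by rewrite e0 e1 e01.
  by move/f_inj/eqP; rewrite eq_Tagged.
have adjF (b c : nat) (ltb : b < t p) (ltc : c < t q) (u u' : F) :
    f (v p b ltb) = inl (inl u) -> f (v q c ltc) = inl (inl u') -> adj u u'.
  by move=> eu eu'; have := f_adj (v p b ltb) (v q c ltc) npq; rewrite eu eu'.
apply: (C4free p0 p1 q0 q1).
- exact: neq e_p0 e_p1.
- exact: neq e_q0 e_q1.
- exact: adjF e_p0 e_q0.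
- exact: adjF e_p0 e_q1.
- exact: adjF e_p1 e_q0.
- exact: adjF e_p1 e_q1.
Qed.

Lemma no_perfect_packing_of_uncovered (H G : sgraph) (v : G) :
  (forall f : {ffun H -> G}, is_copy f -> v \notin copy_vertices f) ->
  ~ exists P : {set {ffun H -> G}}, perfect_packing P.
Proof.
move=> uncov [P [[copyP _] cover]].
have : v \in \bigcup_(f in P) copy_vertices f by rewrite cover inE.
by case/bigcupP => f /copyP /uncov /negP.
Qed.

(** * The construction *)

(** Here r = m + 3, and q = 9 r^3 C^2 expresses that C = sqrt n / (3 r^2) for
    n = r q; in terms of m and q all degrees and sizes are natural numbers. *)
Lemma extremal_graph (m C q : nat) (t : 'I_m.+3 -> nat) :
  (forall i, 2 <= t i) -> 0 < C -> q = 9 * m.+3 ^ 3 * C ^ 2 ->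
  exists G : sgraph,
    [/\ #|G| = m.+3 * q,
        forall i, 1 <= i <= q ->
          m.+1 * q + i + C <= nth 0 (degree_sequence G) i.-1
      & ~ exists P : {set {ffun complete_multipartite t -> G}},
            perfect_packing P].
Proof.
move=> t2 C_gt0 q_def.
(* k centres of degree L inside F: L lifts the degree of a centre in G from
   (r-1)q - (r-2)C - 1 to (r-1)q + C, and k is the number for which v and the
   non-centres number q - (r-1)C - 1, the last index they can serve. *)
pose k := (2 * m + 3) * C + 3.
pose L := m.+2 * C + 1.
have room : k * L.+1 <= q + m.+1 * C + 1.
  rewrite q_def /k /L; nia.
pose e := q + m.+1 * C + 1 - k * L.+1.
have lemC2q : m.+2 * C + 2 <= q by rewrite q_def; nia.
have leCq : C + 2 <= q by clear -lemC2q; lia.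
pose a := q - C.
pose w := 2 * q - C - 2.
pose F := star_forest k L e.
pose T := complete_multipartite (fun _ : 'I_m => a).
pose Q := pointed_clique w.
pose G := join (join F T) Q.
have lemCq : m * C <= m * q by rewrite leq_mul2l; apply/orP; right; lia.
have cF : #|F| = q + m.+1 * C + 1 by rewrite card_star_forest subnKC.
have cT : #|T| = m * a.
  by rewrite card_complete_multipartite sum_nat_const card_ord.
have cQ : #|Q| = w.+1 by rewrite card_pointed_clique.
have cN : #|join F T| = m.+1 * q + C + 1.
  rewrite card_sum cF cT /a mulnBr !mulSn; clear -lemCq leCq; lia.
have cG : #|G| = m.+3 * q.
  rewrite card_sum cN cQ /w !mulSn; clear -leCq; lia.
exists G; split=> //; last first.
  apply: (@no_perfect_packing_of_uncovered _ G (inr None)) => f.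
  exact/apex_not_covered/star_forest_C4_free.
move=> i /andP [i_gt0 leiq].
set b := m.+1 * q + i + C.
apply: (@degree_sequence_geq G).
  by rewrite cG; apply: leq_trans (leq_pmull _ _) => //; rewrite prednK.
(* In the pointed clique only v can be low, and it is so exactly for i > 1
   because its degree is (r-2)q + C + 1. *)
have lowQ : #|[pred x : Q | degree x + #|join F T| < b]| <= (1 < i).
  have dE : b - #|join F T| = i.-1 by rewrite cN /b; clear; lia.
  have lew : i.-1 <= w.-1 by rewrite /w; clear -leCq leiq; lia.
  have := card_low_pointed_clique lew; rewrite -dE.
  have -> : (0 < b - #|join F T|) = (1 < i) by rewrite dE; clear; lia.
  apply: leq_trans; apply: eq_leq; apply: eq_card => x.
  by rewrite !inE ltn_subRL addnC.
have lowT : #|[pred x : T | degree x + #|F| + #|Q| < b]| = 0.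
  apply: eq_card0 => x; rewrite !inE; apply/negbTE; rewrite -leqNgt.
  have m_gt0 : 0 < m by case: (tag x) => j ltj; apply: leq_trans ltj.
  rewrite degree_complete_multipartite cT cF cQ /b /a /w mulnBr !mulSn.
  have : q <= m * q by rewrite leq_pmull.
  clear -lemCq leCq leiq; lia.
(* The bound forces degree d inside F. If d = 0 there is no low vertex in F; if
   d > 0 then i > q - (r-1)C - 1, which is the number of non-centres plus one,
   the one being v. *)
have lowF : #|[pred x : F | degree x + #|T| + #|Q| < b]| + (1 < i) <= i.-1.
  pose d := b - (#|T| + #|Q|).
  have dE : d = i + m.+2 * C + 1 - q.
    rewrite /d cT cQ /b /a /w mulnBr !mulSn; clear -lemCq leCq; lia.
  have ledL : d <= L by rewrite dE /L; clear -leiq; lia.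
  have lowE : [pred x : F | degree x + #|T| + #|Q| < b] =i
              [pred x : F | degree x < d].
    by move=> x; rewrite !inE /d ltn_subRL [_ + degree x]addnC addnA.
  rewrite (eq_card lowE); case: (posnP d) => [d0|d_gt0].
    rewrite d0 eq_card0 // add0n; clear.
    by case: i => [|[]].
  have low_count := card_low_star_forest k e ledL.
  apply: (leq_trans (leq_add low_count (leq_b1 (1 < i)))).
  have -> : k * L + e = q + m.+1 * C + 1 - k.
    by rewrite /e mulnS; clear -room; lia.
  move: d_gt0 lemC2q; rewrite dE /k mulnDl -mulnA !mulSn.
  clear; lia.
rewrite card_low_join.
have -> : #|[pred x : join F T | degree x + #|Q| < b]| =
          #|[pred x : F | degree x + #|T| + #|Q| < b]|.
  rewrite card_sum_pred -[RHS]addn0 -lowT; congr (_ + _);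
    apply: eq_card => x; rewrite !inE.
  - by rewrite degree_joinl.
  - by rewrite degree_joinr.
exact: leq_trans (leq_add (leqnn _) lowQ) lowF.
Qed.

Theorem proposition3p1 :
  forall (r : nat) (t : 'I_r -> nat),
    3 <= r ->
    (forall i : 'I_r, 2 <= t i) ->
    let H := complete_multipartite t in
    exists n0 : nat, forall n : nat, n0 <= n ->
      forall sqrtn : nat, sqrtn ^ 2 = n ->
      6 * r ^ 2 * #|H| %| sqrtn ->
      let C : rat := (sqrtn%:R / (3 * r%:R ^+ 2))%R in
      exists G : sgraph,
        [/\ #|G| = n,
            forall i : nat, 1 <= i -> (i%:R <= n%:R / r%:R :> rat)%R ->
              ((r%:R - 2) * n%:R / r%:R + i%:R + C
                 <= (nth 0%N (degree_sequence G) i.-1)%:R :> rat)%R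
          & ~ exists P : {set {ffun H -> G}}, perfect_packing P].
Proof.
move=> [|[|[|m]]] t // _ t2 H; exists 1 => n n_gt0 s s2 /dvdnP [d s_def] C.
pose c := 2 * #|H| * d.
have s_c : s = 3 * m.+3 ^ 2 * c by rewrite s_def /c; ring.
have c_gt0 : 0 < c.
  by rewrite lt0n; apply: contraTneq n_gt0 => c0; rewrite -s2 s_c c0 muln0.
pose q := 9 * m.+3 ^ 3 * c ^ 2.
have n_q : n = m.+3 * q by rewrite -s2 s_c /q; ring.
have r0 : (m.+3%:R != 0 :> rat)%R by rewrite pnatr_eq0.
have m1E : (m.+1%:R = m.+3%:R - 2 :> rat)%R by rewrite -addn2 natrD addrK.
have CE : (C = c%:R)%R.
  by rewrite /C s_c !natrM; field; rewrite -natrD pnatr_eq0.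
have [G [cG degG noP]] := extremal_graph t2 c_gt0 (erefl q).
exists G; split=> // [|i i_gt0]; first by rewrite cG n_q.
have -> : (n%:R / m.+3%:R = q%:R :> rat)%R by rewrite n_q natrM mulrAC divff ?mul1r.
rewrite ler_nat => leiq.
have -> : ((m.+3%:R - 2) * n%:R / m.+3%:R + i%:R + C
            = (m.+1 * q + i + c)%:R :> rat)%R.
  by rewrite CE (natrD _ _ c) (natrD _ _ i) n_q 2!(natrM _ _ q) m1E mulrCA mulrAC divff // mul1r.
by rewrite ler_nat; apply: degG; rewrite i_gt0.
Qed.
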